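(* Let $\alpha\in L^1(\mathbb{R})$ be even with $\alpha\ge0$ almost everywhere, and let $w\in C^1(\mathbb{R})$ be odd with $w(0)=0$; set $W(\eta)=\int_0^\eta w(\rho)\,d\rho$. Let $\varphi,\psi\in L^1(\mathbb{R})\cap L^\infty(\mathbb{R})$. Suppose there is some $\nu>0$ such that $$\eta\, w(\eta)\le 2(1+2\nu)W(\eta)\quad\text{for all }\eta\in\mathbb{R},$$ and $$E(0)=\frac12\|\psi\|_2^2+\frac12\int_{\mathbb{R}^2}\alpha(y-x)\,W\big(\varphi(y)-\varphi(x)\big)\,dy\,dx<0.$$ Then the solution $u$ (in $C^2([0,T],L^1(\mathbb{R})\cap L^\infty(\mathbb{R}))$ for $T$ less than the maximal existence time) of the Cauchy problem $$u_{tt}(x,t)=\int_{\mathbb{R}} \alpha(y-x)\, w\big(u(y,t)-u(x,t)\big)\,dy,\quad x\in\mathbb{R},\ t>0,\qquad u(x,0)=\varphi(x),\ u_t(x,0)=\psi(x)$$ blows up in finite time, i.e. it does not exist globally in time. *)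

(* Defs.v *)
From HB Require Import structures.
From mathcomp Require Import all_boot all_order all_algebra.
From mathcomp Require Import all_classical all_reals all_analysis ess_sup_inf.
Set Implicit Arguments. Unset Strict Implicit. Unset Printing Implicit Defensive.
Import Order.TTheory GRing.Theory Num.Theory.
Import numFieldNormedType.Exports.
Local Open Scope classical_set_scope.
Local Open Scope ring_scope.

Section defs.
Context {R : realType}.
Local Notation mu := (@lebesgue_measure R).

Definition inL1 (f : R -> R) : Prop := mu.-integrable setT (EFin \o f).

Definition inLinf (f : R -> R) : Prop :=
  measurable_fun setT f /\ exists M : R, {ae mu, forall x, `|f x| <= M}.

Definition inX (f : R -> R) : Prop := inL1 f /\ inLinf f.

Definition Xnorm (f : R -> R) : \bar R :=
  (\int[mu]_x (`|f x|)%:E + ess_sup mu (fun x => (`|f x|)%:E))%E.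

Definition Xlim (g : R -> R -> R) (t : R) (l : R -> R) : Prop :=
  (fun s => Xnorm (fun x => g s x - l x))
    @ within (fun s => 0 <= s /\ s != t) (nbhs t) --> 0%E.

Definition Xderiv (u v : R -> R -> R) : Prop :=
  forall t, 0 <= t -> Xlim (fun s x => (u s x - u t x) / (s - t)) t (v t).

Definition Xcont (u : R -> R -> R) : Prop :=
  forall t, 0 <= t -> Xlim u t (u t).

Definition XC2 (u u1 u2 : R -> R -> R) : Prop :=
  (forall t, 0 <= t -> inX (u t) /\ inX (u1 t) /\ inX (u2 t)) /\
  Xderiv u u1 /\ Xderiv u1 u2 /\ Xcont u2.

Definition Wprim (w : R -> R) (eta : R) : R :=
  if 0 <= eta then Rintegral mu `[0, eta] w
  else - Rintegral mu `[eta, 0] w.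

Definition Lop (alpha w : R -> R) (v : R -> R) (x : R) : \bar R :=
  \int[mu]_y (alpha (y - x) * w (v y - v x))%:E.

Definition energy0 (alpha w phi psi : R -> R) : \bar R :=
  ((1/2)%:E * \int[mu]_x (psi x ^+ 2)%:E +
   (1/2)%:E * \int[mu]_x \int[mu]_y
      (alpha (y - x) * Wprim w (phi y - phi x))%:E)%E.

Definition global_solution (alpha w phi psi : R -> R) (u : R -> R -> R) : Prop :=
  exists u1 u2 : R -> R -> R,
    XC2 u u1 u2 /\
    (forall t, 0 < t -> {ae mu, forall x, (u2 t x)%:E = Lop alpha w (u t) x}) /\
    {ae mu, forall x, u 0 x = phi x} /\
    {ae mu, forall x, u1 0 x = psi x}.
End defs.

(* Main.v *)
Require Import Defs.
From HB Require Import structures.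
From mathcomp Require Import all_boot all_order all_algebra.
From mathcomp Require Import all_classical all_reals all_analysis.
From mathcomp Require Import measurable_realfun ess_sup_inf.
From mathcomp Require Import ring lra.
Import Order.TTheory GRing.Theory Num.Theory.
Import numFieldNormedType.Exports.
Local Open Scope classical_set_scope.
Local Open Scope ring_scope.

(* Levine's concavity method. Let E(t) be the energy of a global solution u.
   Since W(b) - W(a) - w(a)(b - a) is quadratic in b - a on bounded sets, the
   potential part of E is differentiable along u for the L^1 /\ L^oo norm, and
   symmetrizing the (even) kernel gives E' = 0. With b = - 2 E(0) > 0 put
   F(t) = |u|^2 + b (t + t0)^2. The growth condition on W gives
   F'' >= 4 (1 + nu) (|u_t|^2 + b), and the Cauchy-Schwarz inequality
   (F'/2)^2 <= F (|u_t|^2 + b) turns this into (F'/F)' >= nu (F'/F)^2.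
   For t0 large F'/F is positive at t = 1, so it explodes in finite time. *)

Set Implicit Arguments.
Unset Strict Implicit.

(** * Lebesgue integrals on the line and the plane *)

Section integration.
Context {R : realType}.
Local Notation mu := (@lebesgue_measure R).

(** The two norms do different work. The L^oo bound confines the increments [v y - v x] to a bounded
    interval, where the C^1 function [w] is Lipschitz. The L^1 bound makes plane integrals converge:
    the kernel [alpha (y - x)] alone has infinite mass on the plane unless [alpha] vanishes a.e.,
    but a factor bounded by [|f x| + |f y|] with [f] in L^1 restores integrability. Scalar products
    pair L^1 with L^oo, and a quadratic remainder draws one factor from each norm. The equation is
    given only for t > 0 and derivatives at 0 are one-sided. Differentiation therefore shows that
    the energy is constant on t > 0, and a Lipschitz bound from the right joins this constant to
    E(0). For the same reason the comparison argument starts at the interior time 1. *)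

Lemma ae_le_integrable d (T : measurableType d) (m : {measure set T -> \bar R})
    (f g : T -> R) : measurable_fun setT f -> m.-integrable setT (EFin \o g) ->
  {ae m, forall x, `|f x| <= g x} -> m.-integrable setT (EFin \o f).
Proof.
move=> mf ig fg; apply/integrableP; split; first exact/measurable_EFinP.
have mg : measurable_fun setT g by move/integrableP : ig => [/measurable_EFinP].
have /integrableP[_] := ig; apply: le_lt_trans.
apply: ae_ge0_le_integral => //=.
- by apply/measurable_EFinP; exact: measurableT_comp.
- by apply/measurable_EFinP; exact: measurableT_comp.
- by apply: filterS fg => x fg _; rewrite lee_fin (le_trans fg)// ler_norm.
Qed.

Lemma ae_le_Rintegral d (T : measurableType d) (m : {measure set T -> \bar R})
    (f g : T -> R) : m.-integrable setT (EFin \o f) ->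
  m.-integrable setT (EFin \o g) -> {ae m, forall x, f x <= g x} ->
  \int[m]_x f x <= \int[m]_x g x.
Proof.
move=> fi gi fg; rewrite -subr_ge0 -RintegralB//.
have igf : m.-integrable setT (EFin \o (g \- f)) by exact: (integrableB measurableT gi fi).
(* The difference is nonnegative only a.e.; its absolute value has the same integral and is
   nonnegative everywhere. *)
have -> : \int[m]_x (g x - f x) = \int[m]_x `|g x - f x|.
  congr fine; apply: ae_eq_integral => //.
  - exact: measurable_int igf.
  - exact: measurable_int (integrable_norm igf).
  - by apply: filterS fg => x fg _; rewrite ger0_norm// subr_ge0.
exact: Rintegral_ge0.
Qed.

Lemma ae_eq_Rintegral d (T : measurableType d) (m : {measure set T -> \bar R})
    (f g : T -> R) : measurable_fun setT f -> measurable_fun setT g ->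
  {ae m, forall x, f x = g x} -> \int[m]_x f x = \int[m]_x g x.
Proof.
move=> mf mg fg; congr fine; apply: ae_eq_integral => //.
- exact/measurable_EFinP.
- exact/measurable_EFinP.
- by apply: filterS fg => x -> _.
Qed.

(** Uniqueness of Lebesgue measure: the pushforward is a measure with the right value on half-open
    intervals. *)
Lemma lebesgue_measureD (a : R) (A : set R) : measurable A ->
  pushforward mu ((fun x => x + a) : _ -> measurableTypeR R) A = mu A.
Proof.
move=> mA.
have ma : measurable_fun setT ((fun x => x + a) : measurableTypeR R -> measurableTypeR R).
  by apply: measurable_funD.
(* Bundling the translation as a measurable function gives [pushforward mu f] its structure of
   measure. *)
pose m := isMeasurableFun.Build _ _ _ _ _ ma.
pose f : {mfun _ >-> _} := HB.pack ((fun x => x + a) : measurableTypeR R -> measurableTypeR R) m.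
apply/esym/(@lebesgue_measure_unique _ (pushforward mu f)) => //= _ [[b c]] _ <-.
rewrite /pushforward (_ : _ @^-1` _ = `]b - a, c - a]%classic); last first.
  by apply/seteqP; split => x /=; rewrite !in_itv/= ltrBlDr lerBrDr.
by rewrite !lebesgue_measure_itv/= !lte_fin ltrD2r -!EFinD; congr (if _ then _%:E else _); ring.
Qed.

Lemma ge0_integral_translate (f : R -> \bar R) (a : R) :
  measurable_fun setT f -> (forall x, (0 <= f x)%E) ->
  (\int[mu]_x f (x + a)%R = \int[mu]_x f x)%E.
Proof.
move=> mf f0.
have ma : measurable_fun setT ((fun x => x + a) : measurableTypeR R -> measurableTypeR R).
  by apply: measurable_funD.
have := @ge0_integral_pushforward _ _ _ _ _ _ ma mu setT f measurableT mf (fun y _ => f0 y).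
rewrite preimage_setT => <-.
by apply: eq_measure_integral => //= A mA AS; exact/lebesgue_measureD.
Qed.

Lemma ge0_integral_reflect (f : R -> \bar R) (a : R) :
  measurable_fun setT f -> (forall x, (0 <= f x)%E) ->
  (\int[mu]_x f (a - x)%R = \int[mu]_x f x)%E.
Proof.
move=> mf f0; rewrite -[RHS](@ge0_integral_translate f a)//.
have mN : measurable_fun setT (-%R : measurableTypeR R -> measurableTypeR R) by [].
have mfa : measurable_fun setT (fun x : R => f (x + a)).
  by apply: measurableT_comp => //; exact: measurable_funD.
have := @ge0_integral_pushforward _ _ _ _ _ _ mN mu setT _ measurableT mfa (fun y _ => f0 _).
rewrite preimage_setT => /=.
under [X in _ = X -> _]eq_integral do rewrite addrC.
move=> <-.
by apply: eq_measure_integral => //= A mA AS; exact/lebesgue_measureN.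
Qed.

Local Notation mu2 := (mu \x mu)%E.

Lemma ae_fst (P : R -> Prop) :
  {ae mu, forall x, P x} -> {ae mu2, forall p, P p.1}.
Proof.
move=> [N [mN N0 PN]]; exists (N `*` setT); split.
- exact: measurableX.
- by rewrite product_measure1E// [X in (X * _)%E](_ : _ = 0%E)// mul0e.
- by move=> p /= Pp; split => //; exact: PN.
Qed.

Lemma ae_snd (P : R -> Prop) :
  {ae mu, forall x, P x} -> {ae mu2, forall p, P p.2}.
Proof.
move=> [N [mN N0 PN]]; exists (setT `*` N); split.
- exact: measurableX.
- by rewrite product_measure1E// [X in (_ * X)%E](_ : _ = 0%E)// mule0.
- by move=> p /= Pp; split => //; exact: PN.
Qed.

Lemma measurable_diff : measurable_fun setT (fun p : R * R => p.2 - p.1).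
Proof. by apply: measurable_funB. Qed.

(** Each vertical section of the exceptional set is a translate of the null set [N], hence null, and
    the product measure integrates these sections. *)
Lemma ae_diff (P : R -> Prop) :
  {ae mu, forall x, P x} -> {ae mu2, forall p, P (p.2 - p.1)}.
Proof.
move=> [N [mN N0 PN]]; exists ((fun p : R * R => p.2 - p.1) @^-1` N); split.
- by rewrite -[X in measurable X]setTI; exact: measurable_diff.
- rewrite /product_measure1 /= integral0_eq// => x _.
  by rewrite /= xsectionE; move: N0; rewrite -(lebesgue_measureD (- x)).
- by move=> p /= Pp; exact: PN.
Qed.

(** By Tonelli, integrability can be tested on the iterated integral in either order, and swapping
    the variables exchanges the two orders. *)
Lemma integrable_swap_prod (f : R * R -> R) : mu2.-integrable setT (EFin \o f) ->
  mu2.-integrable setT (EFin \o (fun p => f (p.2, p.1))).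
Proof.
move=> fi; have mf := measurable_int _ fi.
have ms : measurable_fun setT (EFin \o (fun p : R * R => f (p.2, p.1))).
  by apply: (measurableT_comp mf); exact: measurable_swap.
apply/(integrable21ltyP mu mu ms).
have /(integrable12ltyP mu mu mf) := fi; exact.
Qed.

Lemma Rintegral_swap_prod (f : R * R -> R) : mu2.-integrable setT (EFin \o f) ->
  \int[mu2]_p f (p.2, p.1) = \int[mu2]_p f p.
Proof.
move=> fi; have fi' := integrable_swap_prod fi.
rewrite /Rintegral; congr fine.
have /= <- := integral12_prod_meas1 fi.
have /= <- := integral21_prod_meas1 fi'.
rewrite /fubini_F /fubini_G.
reflexivity.
Qed.

End integration.

(** * Bounded integrable functions *)

Section L1_Linf.
Context {R : realType}.
Local Notation mu := (@lebesgue_measure R).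

#[global] Instance lebesgue_ae_filter : Filter (nbhs (almost_everywhere mu)).
Proof. exact: ae_filter_ringOfSetsType. Qed.

(** A real-valued substitute for [Xnorm f <= e]: one number bounds both norms, so [Xnorm f <= e]
    implies the two bounds and they imply [Xnorm f <= 2 e]. *)
Definition Xbd (f : R -> R) (e : R) : Prop :=
  [/\ mu.-integrable setT (EFin \o f), \int[mu]_x `|f x| <= e
    & {ae mu, forall x, `|f x| <= e}].

Definition dot (f g : R -> R) : R := \int[mu]_x (f x * g x).

Lemma Xbd_ge0 f e : Xbd f e -> 0 <= e.
Proof. by case=> _ h _; apply: le_trans h; exact: Rintegral_ge0. Qed.

Lemma Xbd_measurable f e : Xbd f e -> measurable_fun setT f.
Proof. by case=> /measurable_int /measurable_EFinP. Qed.

Lemma Xbd_integrable f e : Xbd f e -> mu.-integrable setT (EFin \o f).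
Proof. by case. Qed.

Lemma Xbd_le f e e' : e <= e' -> Xbd f e -> Xbd f e'.
Proof.
move=> ee' [fi f1 foo]; split => //; first exact: le_trans ee'.
by apply: filterS foo => x /le_trans; exact.
Qed.

Lemma inX_Xbd f : inX f -> exists e, Xbd f e.
Proof.
move=> [fi [mf [M fM]]]; exists (Num.max (\int[mu]_x `|f x|) M); split => //.
- by rewrite le_max lexx.
- by apply: filterS fM => x fM; rewrite le_max fM orbT.
Qed.

Lemma XbdD f g a b : Xbd f a -> Xbd g b -> Xbd (fun x => f x + g x) (a + b).
Proof.
move=> [fi f1 foo] [gi g1 goo].
have fgi : mu.-integrable setT (EFin \o (fun x => f x + g x)).
  exact: (integrableD measurableT fi gi).
split => //.
- apply: le_trans (lerD f1 g1).
  have nfi := integrable_norm fi.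
  have ngi := integrable_norm gi.
  rewrite -RintegralD//.
  apply: le_Rintegral => //; first exact: (integrable_norm fgi).
    exact: (integrableD measurableT nfi ngi).
  by move=> x _; exact: ler_normD.
- apply: filterS2 foo goo => x fa gb.
  by rewrite (le_trans (ler_normD _ _))// lerD.
Qed.

Lemma XbdZ f a k : Xbd f a -> Xbd (fun x => k * f x) (`|k| * a).
Proof.
move=> [fi f1 foo]; split.
- exact: (integrableZl measurableT k fi).
- under eq_Rintegral do rewrite normrM.
  rewrite RintegralZl//; last exact: (integrable_norm fi).
  by rewrite ler_wpM2l.
- by apply: filterS foo => x fa; rewrite normrM ler_wpM2l.
Qed.

Lemma XbdB f g a b : Xbd f a -> Xbd g b -> Xbd (fun x => f x - g x) (a + b).
Proof.
move=> fa /(@XbdZ _ _ (-1)); rewrite normrN1 mul1r => gb.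
have := XbdD fa gb; congr Xbd; apply/funext => x; by rewrite mulN1r.
Qed.

Lemma Xlim_Xbd (g : R -> R -> R) (t : R) (l : R -> R) :
  (forall s : R, 0 <= s -> s != t -> inX (fun x => g s x - l x)) -> Xlim g t l ->
  forall e : R, 0 < e -> \forall s \near t, 0 <= s -> s != t ->
    Xbd (fun x => g s x - l x) e.
Proof.
move=> gX glim e e0.
have : nbhs (0%E : \bar R) [set y | (y < e%:E)%E].
  by apply: open_ereal_lt'; rewrite lte_fin.
move=> /glim near_e.
have {near_e} : \forall s \near t, 0 <= s /\ s != t ->
  (Xnorm (fun x => g s x - l x)%R < e%:E)%E := near_e.
apply: filterS => s sP s0 st; have {sP} := sP (conj s0 st).
have [gi [mg _]] := gX s s0 st.
rewrite /Xnorm => /ltW nle.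
have i0 : (0 <= \int[mu]_x (`|g s x - l x|)%:E)%E by apply: integral_ge0.
(* The L^1 part is at most [Xnorm] only if the essential supremum is nonnegative; this uses that the
   whole line has positive measure, witnessed by [[0, 1]]. *)
have s0' : (0 <= ess_sup mu (fun x => (`|g s x - l x|)%:E))%E.
  apply: ess_sup_gee; last by apply: aeW => x; rewrite lee_fin.
  apply: (@lt_le_trans _ _ (mu `[0, 1])).
    by rewrite lebesgue_measure_itv/= lte_fin ltr01 oppr0 adde0 lte_fin ltr01.
  by apply: le_measure; rewrite ?inE//; exact: measurable_itv.
split => //.
- rewrite -lee_fin /Rintegral fineK; last first.
    exact: integrable_fin_num (integrable_norm gi).
  by apply: le_trans nle; rewrite leeDl.
- have : (ess_sup mu (fun x => (`|g s x - l x|)%:E) <= e%:E)%E.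
    by apply: le_trans nle; rewrite leeDr.
  by move/ess_supP; apply: filterS => x; rewrite lee_fin.
Qed.

Lemma dotC f g : dot f g = dot g f.
Proof. by apply: eq_Rintegral => x _; rewrite mulrC. Qed.

(** Hölder's inequality between L^1 and L^oo; it replaces any appeal to the space L^2. *)
Lemma dot_bound f g a b : Xbd f a -> Xbd g b ->
  mu.-integrable setT (EFin \o (fun x => f x * g x)) /\ `|dot f g| <= a * b.
Proof.
move=> fa gb; have b0 := Xbd_ge0 gb.
have [mf mg] := (Xbd_measurable fa, Xbd_measurable gb).
move: fa gb => [fi f1 foo] [gi g1 goo].
have bf : mu.-integrable setT (EFin \o (fun x => b * `|f x|)).
  exact: (integrableZl measurableT b (integrable_norm fi)).
have fgb : {ae mu, forall x, `|f x * g x| <= b * `|f x|}.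
  by apply: filterS goo => x gb; rewrite normrM mulrC ler_wpM2r.
have fgi : mu.-integrable setT (EFin \o (fun x => f x * g x)).
  by apply: ae_le_integrable bf _ => //; exact: measurable_funM.
split => //.
rewrite /dot (le_trans (le_normr_Rintegral measurableT fgi))//.
have nfgi : mu.-integrable setT (EFin \o (fun x => `|f x * g x|)).
  exact: (integrable_norm fgi).
rewrite (le_trans (ae_le_Rintegral nfgi bf fgb))//.
rewrite RintegralZl//; last exact: (integrable_norm fi).
by rewrite mulrC ler_wpM2r.
Qed.

Lemma dotZl f g a b k : Xbd f a -> Xbd g b ->
  dot (fun x => k * f x) g = k * dot f g.
Proof.
move=> fa gb; have [fi _] := dot_bound fa gb.
by rewrite -RintegralZl//; apply: eq_Rintegral => x _; rewrite mulrA.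
Qed.

Lemma dotBl f f' g a a' b : Xbd f a -> Xbd f' a' -> Xbd g b ->
  dot (fun x => f x - f' x) g = dot f g - dot f' g.
Proof.
move=> fa fa' gb.
have [[fi _] [fi' _]] := (dot_bound fa gb, dot_bound fa' gb).
by rewrite -RintegralB//; apply: eq_Rintegral => x _; rewrite mulrBl.
Qed.

Lemma dotff_ge0 f : 0 <= dot f f.
Proof. by apply: Rintegral_ge0 => x _; exact: sqr_ge0. Qed.

(* Cauchy-Schwarz in the direct sum of L^2 and the line with scalar product
   [b s t], obtained by expanding the squared norm of [A v - B u]. *)
Lemma cauchy_schwarz_plus u v a c b t : Xbd u a -> Xbd v c -> 0 <= b ->
  0 < dot u u + b * t ^+ 2 ->
  (dot u v + b * t) ^+ 2 <= (dot u u + b * t ^+ 2) * (dot v v + b).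
Proof.
move=> ua vc b0; set A := (dot u u + _); set B := (dot u v + _) => A0.
have Av := XbdZ A vc; have Bu := XbdZ B ua.
have := dotff_ge0 (fun x => A * v x - B * u x).
have AB := XbdB Av Bu.
rewrite (dotBl Av Bu AB) (dotZl A vc AB) (dotZl B ua AB).
rewrite (dotC v) (dotC u) (dotBl Av Bu vc) (dotBl Av Bu ua).
rewrite (dotZl A vc vc) (dotZl B ua vc) (dotZl A vc ua) (dotZl B ua ua).
rewrite (dotC v u) => h1.
have h2 : 0 <= b * (A - B * t) ^+ 2 by rewrite mulr_ge0// sqr_ge0.
rewrite -(ler_pM2l A0) -subr_ge0.
apply: le_trans (addr_ge0 h1 h2) _.
by rewrite /B /A le_eqVlt; apply/orP; left; apply/eqP; ring.
Qed.

End L1_Linf.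

(** * Integrals against a difference kernel *)

Section kernel.
Context {R : realType}.
Local Notation mu := (@lebesgue_measure R).
Local Notation mu2 := (mu \x mu)%E.

#[global] Instance lebesgue2_ae_filter : Filter (nbhs (almost_everywhere mu2)).
Proof. exact: ae_filter_ringOfSetsType. Qed.

Variable alpha : R -> R.
Hypothesis alpha_int : mu.-integrable setT (EFin \o alpha).
Hypothesis alpha_even : {ae mu, forall x, alpha (- x) = alpha x}.
Hypothesis alpha_ge0 : {ae mu, forall x, 0 <= alpha x}.

Definition kernel_integrable (g : R * R -> R) : Prop :=
  mu2.-integrable setT (EFin \o (fun p => alpha (p.2 - p.1) * g p)).

Definition kernel_int (g : R * R -> R) : R := \int[mu2]_p (alpha (p.2 - p.1) * g p).

Let malpha : measurable_fun setT alpha.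
Proof. by apply/measurable_EFinP; exact: measurable_int alpha_int. Qed.

Let mkernel : measurable_fun setT (fun p : R * R => alpha (p.2 - p.1)).
Proof. by apply: (measurableT_comp malpha); exact: measurable_diff. Qed.

(** Tonelli with [y] integrated first: for fixed [x], translation invariance makes the inner
    integral of [|alpha (y - x)|] equal to the L^1 norm of [alpha]. *)
Lemma kernel_fst (f : R -> R) : mu.-integrable setT (EFin \o f) ->
  kernel_integrable (fun p => f p.1) /\
  \int[mu2]_p `|alpha (p.2 - p.1) * f p.1|
    = (\int[mu]_x `|alpha x|) * (\int[mu]_x `|f x|).
Proof.
move=> fi; have mf : measurable_fun setT f by apply/measurable_EFinP; exact: measurable_int fi.
have mg : measurable_fun setT (EFin \o (fun p : R * R => alpha (p.2 - p.1) * f p.1)).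
  apply/measurable_EFinP; apply: measurable_funM => //.
  by apply: (measurableT_comp mf).
have nai := integrable_norm alpha_int; have nfi := integrable_norm fi.
have E : (\int[mu2]_p `|alpha (p.2 - p.1) * f p.1|%:E =
   (\int[mu]_x `|alpha x|%:E) * (\int[mu]_x `|f x|%:E))%E.
  pose h (p : R * R) : \bar R := `|alpha (p.2 - p.1) * f p.1|%:E.
  have mh : measurable_fun setT h by exact: (measurableT_comp (@abse_measurable R setT) mg).
  have h0 p : (0 <= h p)%E by rewrite lee_fin.
  transitivity (\int[mu]_x fubini_F mu h x)%E.
    exact: (fubini_tonelli1 (m1 := mu) (m2 := mu) h mh h0).
  rewrite -ge0_integralZl//; last 2 first.
  - by exact: measurable_int nfi.
  - by apply: integral_ge0 => x _; rewrite lee_fin.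
  apply: eq_integral => x _; rewrite /fubini_F/=.
  have -> : (\int[mu]_y h (x, y) = `|f x|%:E * \int[mu]_y `|alpha (y - x)|%:E)%E.
    rewrite -ge0_integralZl//; last first.
      apply/measurable_EFinP; apply: measurableT_comp => //.
      by apply: (measurableT_comp malpha); exact: measurable_funB.
    by apply: eq_integral => y _; rewrite /h normrM mulrC EFinM.
  rewrite muleC; congr (_ * _)%E.
  apply: (@ge0_integral_translate R (fun z => `|alpha z|%:E) (- x)).
    exact: measurable_int nai.
  by move=> z; rewrite lee_fin.
have Efin : (\int[mu2]_p `|alpha (p.2 - p.1) * f p.1|%:E \is a fin_num)%E.
  by rewrite E fin_numM//; exact: integrable_fin_num.
split; last first.
  by rewrite /Rintegral E fineM//; exact: integrable_fin_num.
apply/integrableP; split => //.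
by move: Efin; rewrite fin_numElt => /andP[].
Qed.

(** Counterpart of [kernel_fst] with [x] integrated first, so that the inner change of variable is
    the reflection [x |-> y - x]. *)
Lemma kernel_snd (f : R -> R) : mu.-integrable setT (EFin \o f) ->
  kernel_integrable (fun p => f p.2) /\
  \int[mu2]_p `|alpha (p.2 - p.1) * f p.2|
    = (\int[mu]_x `|alpha x|) * (\int[mu]_x `|f x|).
Proof.
move=> fi; have mf : measurable_fun setT f by apply/measurable_EFinP; exact: measurable_int fi.
have mg : measurable_fun setT (EFin \o (fun p : R * R => alpha (p.2 - p.1) * f p.2)).
  apply/measurable_EFinP; apply: measurable_funM => //.
  by apply: (measurableT_comp mf).
have nai := integrable_norm alpha_int; have nfi := integrable_norm fi.
have E : (\int[mu2]_p `|alpha (p.2 - p.1) * f p.2|%:E =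
   (\int[mu]_x `|alpha x|%:E) * (\int[mu]_x `|f x|%:E))%E.
  pose h (p : R * R) : \bar R := `|alpha (p.2 - p.1) * f p.2|%:E.
  have mh : measurable_fun setT h by exact: (measurableT_comp (@abse_measurable R setT) mg).
  have h0 p : (0 <= h p)%E by rewrite lee_fin.
  transitivity (\int[mu]_x fubini_G mu h x)%E.
    exact: (fubini_tonelli2 (m1 := mu) (m2 := mu) h mh h0).
  rewrite -ge0_integralZl//; last 2 first.
  - by exact: measurable_int nfi.
  - by apply: integral_ge0 => x _; rewrite lee_fin.
  apply: eq_integral => y _; rewrite /fubini_G/=.
  have -> : (\int[mu]_x h (x, y) = `|f y|%:E * \int[mu]_x `|alpha (y - x)|%:E)%E.
    rewrite -ge0_integralZl//; last first.
      apply/measurable_EFinP; apply: measurableT_comp => //.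
      by apply: (measurableT_comp malpha); exact: measurable_funB.
    by apply: eq_integral => x _; rewrite /h normrM mulrC EFinM.
  rewrite muleC; congr (_ * _)%E.
  apply: (@ge0_integral_reflect R (fun z => `|alpha z|%:E) y).
    exact: measurable_int nai.
  by move=> z; rewrite lee_fin.
have Efin : (\int[mu2]_p `|alpha (p.2 - p.1) * f p.2|%:E \is a fin_num)%E.
  by rewrite E fin_numM//; exact: integrable_fin_num.
split; last first.
  by rewrite /Rintegral E fineM//; exact: integrable_fin_num.
apply/integrableP; split => //.
by move: Efin; rewrite fin_numElt => /andP[].
Qed.

(** The estimate behind all plane integrals below: domination by [kernel_fst] and [kernel_snd], each
    contributing one of the two copies of the product of L^1 norms. *)
Lemma kernel_int_bound (g : R * R -> R) (f : R -> R) (C : R) :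
  measurable_fun setT g -> mu.-integrable setT (EFin \o f) ->
  {ae mu2, forall p, `|g p| <= C * (`|f p.1| + `|f p.2|)} ->
  kernel_integrable g /\
  `|kernel_int g| <= C * (2 * (\int[mu]_x `|alpha x|) * (\int[mu]_x `|f x|)).
Proof.
move=> mg fi gf.
have [/integrable_norm i1 e1] := kernel_fst fi.
have [/integrable_norm i2 e2] := kernel_snd fi.
have {}i1 : mu2.-integrable setT (EFin \o (fun p => `|alpha (p.2 - p.1) * f p.1|)) by [].
have {}i2 : mu2.-integrable setT (EFin \o (fun p => `|alpha (p.2 - p.1) * f p.2|)) by [].
pose G (p : R * R) := `|alpha (p.2 - p.1) * f p.1| + `|alpha (p.2 - p.1) * f p.2|.
have iG : mu2.-integrable setT (EFin \o G) by exact: (integrableD measurableT i1 i2).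
have iCG : mu2.-integrable setT (EFin \o (fun p => C * G p)).
  exact: (integrableZl measurableT C iG).
have le : {ae mu2, forall p, `|alpha (p.2 - p.1) * g p| <= C * G p}.
  apply: filterS gf => p gp; rewrite /G !normrM -mulrDr mulrCA.
  by rewrite ler_wpM2l.
have Kg : kernel_integrable g.
  by apply: ae_le_integrable iCG le; exact: measurable_funM.
have nKg : mu2.-integrable setT (EFin \o (fun p => `|alpha (p.2 - p.1) * g p|)).
  exact: (integrable_norm Kg).
split=> //; rewrite /kernel_int (le_trans (le_normr_Rintegral measurableT Kg))//.
rewrite (le_trans (ae_le_Rintegral nKg iCG le))// RintegralZl//.
rewrite RintegralD// e1 e2 le_eqVlt; apply/orP; left; apply/eqP; ring.
Qed.

(** The sign of [alpha] enters through this comparison, which later integrates the pointwise growth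
    condition. *)
Lemma kernel_int_le (g g' : R * R -> R) : kernel_integrable g -> kernel_integrable g' ->
  (forall p, g p <= g' p) -> kernel_int g <= kernel_int g'.
Proof.
move=> gi gi' gg'; apply: ae_le_Rintegral => //.
by apply: filterS (ae_diff alpha_ge0) => p a0; rewrite ler_wpM2l.
Qed.

(** Evenness of [alpha] makes the kernel symmetric for almost every pair of points. *)
Lemma kernel_int_swap (g : R * R -> R) : measurable_fun setT g -> kernel_integrable g ->
  kernel_int (fun p => g (p.2, p.1)) = kernel_int g.
Proof.
move=> mg gi; rewrite /kernel_int -(Rintegral_swap_prod gi)/=.
have ms : measurable_fun setT (fun p : R * R => g (p.2, p.1)).
  by apply: (measurableT_comp mg); exact: measurable_swap.
apply: ae_eq_Rintegral.
- exact: measurable_funM.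
- apply: measurable_funM => //.
  by apply: (measurableT_comp malpha); exact: measurable_funB.
- by apply: filterS (ae_diff alpha_even) => p; rewrite opprB => ->.
Qed.

Lemma kernel_integrable_swap (g : R * R -> R) : measurable_fun setT g -> kernel_integrable g ->
  kernel_integrable (fun p => g (p.2, p.1)).
Proof.
move=> mg gi.
have ms : measurable_fun setT (fun p : R * R => g (p.2, p.1)).
  by apply: (measurableT_comp mg); exact: measurable_swap.
have i : mu2.-integrable setT (EFin \o (fun p => `|alpha (p.1 - p.2) * g (p.2, p.1)|)).
  exact: (integrable_norm (integrable_swap_prod gi)).
apply: ae_le_integrable i _; first exact: measurable_funM.
by apply: filterS (ae_diff alpha_even) => p; rewrite opprB => ->.
Qed.

Lemma kernel_int_lin (a b : R) (g g' : R * R -> R) : kernel_integrable g -> kernel_integrable g' ->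
  kernel_integrable (fun p => a * g p + b * g' p) /\
  kernel_int (fun p => a * g p + b * g' p) = a * kernel_int g + b * kernel_int g'.
Proof.
move=> gi gi'.
have ai : mu2.-integrable setT (EFin \o (fun p => a * (alpha (p.2 - p.1) * g p))).
  exact: (integrableZl measurableT a gi).
have bi : mu2.-integrable setT (EFin \o (fun p => b * (alpha (p.2 - p.1) * g' p))).
  exact: (integrableZl measurableT b gi').
have E : (fun p => alpha (p.2 - p.1) * (a * g p + b * g' p)) =
  (fun p => a * (alpha (p.2 - p.1) * g p) + b * (alpha (p.2 - p.1) * g' p)).
  by apply/funext => p; ring.
rewrite /kernel_integrable /kernel_int E; split; first exact: (integrableD measurableT ai bi).
by rewrite RintegralD// !RintegralZl.
Qed.

End kernel.

(** * The primitive of the nonlinearity *)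

Section primitive.
Context {R : realType}.
Local Notation mu := (@lebesgue_measure R).
Variable w : R -> R.
Hypothesis w_der : forall x, derivable w x 1.
Hypothesis w_C1 : continuous (derive1 w).
Hypothesis w0 : w 0 = 0.

Lemma w_cont : continuous w.
Proof. by move=> x; apply: differentiable_continuous; exact/derivable1_diffP. Qed.

Lemma integrable_w_itv (a b : R) : mu.-integrable `[a, b] (EFin \o w).
Proof.
apply: continuous_compact_integrable; first exact: segment_compact.
by apply: continuous_subspaceT; exact: w_cont.
Qed.

Lemma Wprim0 : Wprim w 0 = 0.
Proof. by rewrite /Wprim lexx set_itv1 Rintegral_set1. Qed.

(** Moving the base point from 0 to some [a] on the left of both 0 and [x] removes the case split of
    [Wprim], so the fundamental theorem of calculus applies uniformly, also around 0. *)
Lemma WprimE (a x : R) : a <= 0 -> a <= x ->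
  Wprim w x = \int[mu]_(t in `[a, x]) w t - \int[mu]_(t in `[a, 0]) w t.
Proof.
move=> a0 ax; rewrite /Wprim; case: ifPn => [x0|].
  rewrite (@Rintegral_itvB _ w (BLeft a) (BRight x) 0) ?bnd_simp//; last exact: integrable_w_itv.
  rewrite Rintegral_itv_obnd_cbnd//.
  by apply: integrableS (integrable_w_itv 0 x) => //; exact: subset_itv_oc_cc.
rewrite -ltNge => /ltW x0; rewrite -[RHS]opprB; congr (- _).
rewrite (@Rintegral_itvB _ w (BLeft a) (BRight 0) x) ?bnd_simp//; last exact: integrable_w_itv.
rewrite Rintegral_itv_obnd_cbnd//.
by apply: integrableS (integrable_w_itv x 0) => //; exact: subset_itv_oc_cc.
Qed.

Lemma Wprim_derive (x : R) : is_derive x 1 (Wprim w) (w x).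
Proof.
pose a := - (`|x| + 1).
have a0 : a <= 0 by rewrite /a oppr_le0 addr_ge0.
have ax : a < x.
  rewrite /a ltrNl; apply: (@le_lt_trans _ _ `|x|); last by rewrite ltrDl.
  by rewrite -normrN ler_norm.
have xu : x < x + 1 by rewrite ltrDl.
have [dF FE] := continuous_FTC1_closed xu (integrable_w_itv a (x + 1)) ax (@w_cont x).
set F := (fun x => _) in dF FE.
have : is_derive x 1 (fun y => F y - \int[mu]_(t in `[a, 0]) w t) (w x).
  rewrite -[w x]subr0; apply: is_deriveB.
  by split => //; rewrite -derive1E.
apply: near_eq_is_derive.
near=> y; rewrite (@WprimE a)//; apply: ltW; near: y.
exact: lt_nbhsr.
Unshelve. all: by end_near. Qed.

Lemma Wprim_cont : continuous (Wprim w).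
Proof.
move=> x; apply: differentiable_continuous; apply/derivable1_diffP.
by have := Wprim_derive x; case.
Qed.

(** Valid for either order of [a] and [b]. The bound on [|c - a|] supplies the second factor of the
    quadratic remainder in [w_bounds]. *)
Lemma mean_value (f df : R -> R) (a b : R) :
  (forall x : R, is_derive x 1 f (df x)) ->
  exists c : R, `|c - a| <= `|b - a| /\ (Num.min a b <= c <= Num.max a b) /\
    f b - f a = df c * (b - a).
Proof.
move=> fd.
have fc : continuous f.
  move=> x; apply: differentiable_continuous; apply/derivable1_diffP.
  by have := fd x; case.
have [ab|/ltW ba] := leP a b.
  have [c /[!in_itv]/= /andP[ac cb] e] := @MVT_segment R f df a b ab (fun x _ => fd x)
    (continuous_subspaceT fc).
  exists c; rewrite ac cb !ger0_norm ?subr_ge0//.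
  by rewrite lerD2r cb.
have [c /[!in_itv]/= /andP[ac cb] e] := @MVT_segment R f df b a ba (fun x _ => fd x)
    (continuous_subspaceT fc).
exists c; rewrite ac cb !ler0_norm ?subr_le0//.
rewrite lerN2 lerD2r ac; split => //; split => //.
by rewrite -[LHS]opprB e -mulrN opprB.
Qed.

(** [C1] and [C2] are the maxima of [|w'|] and [|w|] on [[-M, M]]. The last bound applies the mean
    value theorem twice: the remainder is [(w c - w a) * (b - a)], then
    [w' d * (c - a) * (b - a)]. *)
Lemma w_bounds (M : R) : exists2 C : R, 0 <= C &
  forall a b : R, `|a| <= M -> `|b| <= M ->
  [/\ `|w a| <= C * `|a|, `|Wprim w b - Wprim w a| <= C * `|b - a|
    & `|Wprim w b - Wprim w a - w a * (b - a)| <= C * `|b - a| ^+ 2].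
Proof.
have [M0|M0] := ltP M 0.
  by exists 0 => // a b aM; have := le_lt_trans (le_trans (normr_ge0 a) aM) M0; rewrite ltxx.
have MM : - M <= M by rewrite ge0_cp.
have cn (f : R -> R) : continuous f -> exists2 C : R, 0 <= C & forall x, `|x| <= M -> `|f x| <= C.
  move=> cf; have cnf : continuous (fun x => `|f x|).
    by move=> x; apply: continuous_comp; [exact: cf|exact: norm_continuous].
  have [c _ cm] := @EVT_max R (fun x => `|f x|) (- M) M MM (continuous_subspaceT cnf).
  by exists `|f c| => // x xM; apply: cm; rewrite in_itv/= -ler_norml.
have [C1 C10 w'C] := cn _ w_C1.
have [C2 C20 wC] := cn _ w_cont.
have wd (x : R) : is_derive x 1 w (derive1 w x).
  by split; [exact: w_der|rewrite derive1E].
have minmax a b c : `|a| <= M -> `|b| <= M ->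
    Num.min a b <= c <= Num.max a b -> `|c| <= M.
  rewrite !ler_norml => /andP[a1 a2] /andP[b1 b2] /andP[c1 c2].
  by rewrite (le_trans _ c1) ?le_min ?a1 ?b1//= (le_trans c2)// ge_max a2 b2.
exists (C1 + C2); first exact: addr_ge0.
move=> a b aM bM; split.
- have [c [_ [c2 e]]] := @mean_value w _ 0 a wd.
  move: e; rewrite w0 !subr0 => ->; rewrite normrM ler_wpM2r//.
  by rewrite (@le_trans _ _ C1) ?lerDl// w'C// (minmax 0 a)// normr0.
- have [c [_ [c2 ->]]] := mean_value a b Wprim_derive.
  rewrite normrM ler_wpM2r// (@le_trans _ _ C2) ?lerDr//.
  by rewrite wC// (minmax a b).
- have [c [c1 [c2 ->]]] := mean_value a b Wprim_derive.
  rewrite -mulrBl normrM expr2 mulrA ler_wpM2r//.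
  have cM := minmax _ _ _ aM bM c2.
  have [d [_ [d2 ->]]] := mean_value a c wd.
  rewrite normrM ler_pM//; rewrite (@le_trans _ _ C1) ?lerDl//.
  by rewrite w'C// (minmax a c).
Qed.

End primitive.

(** * The potential energy *)

Section potential.
Context {R : realType}.
Local Notation mu := (@lebesgue_measure R).
Local Notation mu2 := (mu \x mu)%E.

Variables (alpha w : R -> R).
Hypothesis alpha_int : mu.-integrable setT (EFin \o alpha).
Hypothesis alpha_even : {ae mu, forall x, alpha (- x) = alpha x}.
Hypothesis alpha_ge0 : {ae mu, forall x, 0 <= alpha x}.
Hypothesis w_der : forall x, derivable w x 1.
Hypothesis w_C1 : continuous (derive1 w).
Hypothesis w_odd : forall x, w (- x) = - w x.
Hypothesis w0 : w 0 = 0.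

Definition incr (v : R -> R) (p : R * R) : R := v p.2 - v p.1.

Definition potential (v : R -> R) : R := kernel_int alpha (fun p => Wprim w (incr v p)).

Let normalpha := \int[mu]_x `|alpha x|.

Let normalpha_ge0 : 0 <= normalpha.
Proof. by apply: Rintegral_ge0. Qed.

Lemma measurable_incr v : measurable_fun setT v -> measurable_fun setT (incr v).
Proof.
move=> mv; apply: measurable_funB.
  by apply: (measurableT_comp mv).
by apply: (measurableT_comp mv).
Qed.

Lemma incr_bound v M : Xbd v M -> {ae mu2, forall p, `|incr v p| <= 2 * M}.
Proof.
case=> _ _ voo; apply: filterS2 (ae_fst voo) (ae_snd voo) => p v1 v2.
by rewrite (le_trans (ler_normB _ _))// mulr2n mulrDl mul1r lerD.
Qed.

Lemma incr_le v p : `|incr v p| <= `|v p.1| + `|v p.2|.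
Proof. by rewrite addrC ler_normB. Qed.

Let mw (v : R -> R) : measurable_fun setT v ->
  measurable_fun setT (fun p => w (incr v p)).
Proof.
move=> mv; apply: (measurableT_comp _ (measurable_incr mv)).
by apply: continuous_measurable_fun; exact: w_cont.
Qed.

Let mW (v : R -> R) : measurable_fun setT v ->
  measurable_fun setT (fun p => Wprim w (incr v p)).
Proof.
move=> mv; apply: (measurableT_comp _ (measurable_incr mv)).
by apply: continuous_measurable_fun; exact: Wprim_cont.
Qed.

(** Since W(0) = 0, the local Lipschitz bound on W gives [|W (incr v p)| <= C * |incr v p|], the
    form required by [kernel_int_bound]. *)
Lemma kernel_integrable_Wprim v M : Xbd v M ->
  kernel_integrable alpha (fun p => Wprim w (incr v p)).
Proof.
move=> vM; have mv := Xbd_measurable vM.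
have [C C0 HC] := w_bounds w_der w_C1 w0 (2 * M).
have M0 := Xbd_ge0 vM.
have [] // := kernel_int_bound (C := C) alpha_int (mW mv) (Xbd_integrable vM).
apply: filterS (incr_bound vM) => p vp.
have z : `|0 : R| <= 2 * M by rewrite normr0 mulr_ge0.
have [_ + _] := HC _ _ z vp; rewrite Wprim0 !subr0 => /le_trans; apply.
by rewrite ler_wpM2l// incr_le.
Qed.

(** Here [w (incr v p)] is merely bounded and [k] carries the integrability. A general [k] covers
    both [incr h] and the one-variable factor [h p.1] used in [Lop_weak]. *)
Lemma kernel_integrable_w v M h e (k : R * R -> R) : Xbd v M -> Xbd h e ->
  measurable_fun setT k -> (forall p, `|k p| <= `|h p.1| + `|h p.2|) ->
  kernel_integrable alpha (fun p => w (incr v p) * k p).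
Proof.
move=> vM he mk kh; have mv := Xbd_measurable vM.
have [C C0 HC] := w_bounds w_der w_C1 w0 (2 * M).
have M0 := Xbd_ge0 vM.
have mwk : measurable_fun setT (fun p => w (incr v p) * k p).
  by apply: measurable_funM => //; exact: mw.
have [] // := kernel_int_bound (C := C * (2 * M)) alpha_int mwk (Xbd_integrable he).
apply: filterS (incr_bound vM) => p vp.
have [+ _ _] := HC _ _ vp vp => wp.
by rewrite normrM ler_pM// (le_trans wp)// ler_wpM2l.
Qed.

Lemma kernel_integrable_w_incr v M h e : Xbd v M -> Xbd h e ->
  kernel_integrable alpha (fun p => w (incr v p) * incr h p).
Proof.
move=> vM he; apply: (kernel_integrable_w vM he).
  exact: measurable_incr (Xbd_measurable he).
by move=> p; rewrite incr_le.
Qed.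

(** The constant depends on [v] and [M] but not on [v']. The first bound yields continuity at time
    0, the second the derivative at positive times. *)
Lemma potential_taylor v M : Xbd v M -> exists2 C : R, 0 <= C &
  forall v' e, e <= 1 -> Xbd (fun x => v' x - v x) e ->
  `|potential v' - potential v| <= C * e /\
  `|potential v' - potential v -
    kernel_int alpha (fun p => w (incr v p) * incr (fun x => v' x - v x) p)| <= C * e ^+ 2.
Proof.
move=> vM; have mv := Xbd_measurable vM.
(* As [e <= 1], both [v] and [v'] are bounded by [M + 1], so their increments are bounded by twice
   that. *)
have [C C0 HC] := w_bounds w_der w_C1 w0 (2 * (M + 1)).
exists (4 * C * normalpha); first by rewrite !mulr_ge0.
move=> v' e e1 he; have e0 := Xbd_ge0 he.
have v'M : Xbd v' (M + 1).
  have -> : v' = (fun x => v x + (v' x - v x)) by apply/funext => x; ring.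
  by apply: Xbd_le (XbdD vM he); rewrite lerD2l.
have vM1 : Xbd v (M + 1) by apply: Xbd_le vM; rewrite lerDl.
have mv' := Xbd_measurable v'M.
set h := (fun x => v' x - v x) in he *.
have incrh p : incr h p = incr v' p - incr v p by rewrite /incr /h; ring.
have iW := kernel_integrable_Wprim vM.
have iW' := kernel_integrable_Wprim v'M.
have iwh := kernel_integrable_w_incr vM he.
have mh := measurable_incr (Xbd_measurable he).
have h1 : \int[mu]_x `|h x| <= e by case: he.
have [iD KD] := kernel_int_lin 1 (-1) iW' iW.
have [_ KDD] := kernel_int_lin 1 (-1) iD iwh.
split.
- have -> : potential v' - potential v =
    kernel_int alpha (fun p => 1 * Wprim w (incr v' p) + (-1) * Wprim w (incr v p)).
    by rewrite KD mul1r mulN1r.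
  have mg : measurable_fun setT (fun p => 1 * Wprim w (incr v' p) + (-1) * Wprim w (incr v p)).
    by apply: measurable_funD; apply: measurable_funM => //; exact: mW.
  have [|_ b] := kernel_int_bound (C := C) alpha_int mg (Xbd_integrable he).
    apply: filterS2 (incr_bound vM1) (incr_bound v'M) => p vp v'p.
    have [_ + _] := HC _ _ vp v'p; rewrite mul1r mulN1r => /le_trans; apply.
    by rewrite ler_wpM2l// -incrh incr_le.
  apply: (le_trans b); rewrite -/normalpha.
  apply: (@le_trans _ _ (C * (2 * normalpha * e))).
    by rewrite ler_wpM2l// ler_wpM2l// mulr_ge0.
  rewrite (_ : C * _ = 2 * (C * normalpha * e)).
    by rewrite -!mulrA ler_wpM2r ?mulr_ge0// ler_nat.
  by move: normalpha => n; ring.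
- have -> : potential v' - potential v - kernel_int alpha (fun p => w (incr v p) * incr h p) =
    kernel_int alpha (fun p => 1 * (1 * Wprim w (incr v' p) + (-1) * Wprim w (incr v p))
      + (-1) * (w (incr v p) * incr h p)).
    by rewrite KDD KD !mul1r !mulN1r.
  have mg : measurable_fun setT (fun p => 1 * (1 * Wprim w (incr v' p) + (-1) * Wprim w (incr v p))
      + (-1) * (w (incr v p) * incr h p)).
    apply: measurable_funD; apply: measurable_funM => //.
      by apply: measurable_funD; apply: measurable_funM => //; exact: mW.
    by apply: measurable_funM => //; exact: mw.
  (* One factor [|incr h p|] is bounded by [2 * e] through L^oo; the other is kept for the L^1
     estimate, whose own factor 2 makes the constant 4. *)
  have [|_ b] := kernel_int_bound (C := C * (2 * e)) alpha_int mg (Xbd_integrable he).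
    apply: filterS3 (incr_bound vM1) (incr_bound v'M) (incr_bound he) => p vp v'p hp.
    have [_ _ +] := HC _ _ vp v'p; rewrite !mul1r !mulN1r -incrh => /le_trans; apply.
    rewrite -mulrA ler_wpM2l// expr2 ler_pM//.
    by rewrite incr_le.
  apply: (le_trans b); rewrite -/normalpha.
  apply: (@le_trans _ _ (C * (2 * e) * (2 * normalpha * e))).
    by rewrite ler_wpM2l ?mulr_ge0// ler_wpM2l// mulr_ge0.
  by rewrite le_eqVlt; apply/orP; left; apply/eqP; move: normalpha => n; ring.
Qed.

(* Weak form of [q = Lop v]: symmetrizing the kernel turns the test function
   [h x] into [- (h y - h x) / 2]. *)
Lemma Lop_weak v M q a h e : Xbd v M -> Xbd q a -> Xbd h e ->
  {ae mu, forall x, (q x)%:E = Lop alpha w v x} ->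
  kernel_int alpha (fun p => w (incr v p) * incr h p) = - 2 * dot q h.
Proof.
move=> vM qa he qL.
have mh := Xbd_measurable he; have mv := Xbd_measurable vM.
have mh1 : measurable_fun setT (fun p : R * R => h p.1) by apply: (measurableT_comp mh).
have mg : measurable_fun setT (fun p => w (incr v p) * h p.1).
  by apply: measurable_funM => //; exact: mw.
have ig : kernel_integrable alpha (fun p => w (incr v p) * h p.1).
  by apply: (kernel_integrable_w vM he) => // p; rewrite lerDl.
(* Gives integrability of the integrand of [Lop] for almost every [x], so that [h x] can be moved
   inside the inner integral. *)
have i0 : kernel_integrable alpha (fun p => w (incr v p)).
  have [C C0 HC] := w_bounds w_der w_C1 w0 (2 * M).
  have [] // := kernel_int_bound (C := C) alpha_int (mw mv) (Xbd_integrable vM).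
  apply: filterS (incr_bound vM) => p vp.
  have [+ _ _] := HC _ _ vp vp => /le_trans; apply.
  by rewrite ler_wpM2l// incr_le.
have Kg : kernel_int alpha (fun p => w (incr v p) * h p.1) = dot q h.
  rewrite /kernel_int /Rintegral -(integral12_prod_meas1 ig).
  congr fine; apply: ae_eq_integral => //.
  - exact: measurable_fubini_F ig.
  - apply/measurable_EFinP; apply: measurable_funM => //; exact: Xbd_measurable qa.
  - apply: filterS2 qL (ae_integrable1 i0) => x qx ix _.
    rewrite EFinM qx /Lop muleC -integralZl//.
    by apply: eq_integral => y _; rewrite /= -EFinM; congr EFin; rewrite /incr/=; ring.
have isw := kernel_integrable_swap alpha_int alpha_even mg ig.
have Ks := kernel_int_swap alpha_int alpha_even mg ig.
have [_ KL] := kernel_int_lin (-1) (-1) isw ig.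
rewrite -Kg; transitivity (-1 * kernel_int alpha (fun p => w (incr v p) * h p.1) +
   -1 * kernel_int alpha (fun p => w (incr v p) * h p.1)).
  rewrite -{1}Ks -KL; congr kernel_int; apply/funext => p.
  have -> : incr v (p.2, p.1) = - incr v p by rewrite /incr/=; ring.
  by rewrite w_odd /incr /=; ring.
move: (kernel_int _ _) => k; ring.
Qed.

(** Take [v] itself as test function in [Lop_weak] and apply the growth condition at each
    [incr v p]. *)
Lemma dot_Lop_ge v M q a nu : Xbd v M -> Xbd q a ->
  {ae mu, forall x, (q x)%:E = Lop alpha w v x} ->
  (forall eta, eta * w eta <= 2 * (1 + 2 * nu) * Wprim w eta) ->
  - (1 + 2 * nu) * potential v <= dot q v.
Proof.
move=> vM qa qL hc.
have e := Lop_weak vM qa vM qL.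
have iw := kernel_integrable_w_incr vM vM.
have iW := kernel_integrable_Wprim vM.
have [i2 K2] := kernel_int_lin (2 * (1 + 2 * nu)) 0 iW iW.
have := kernel_int_le alpha_ge0 iw i2.
rewrite K2 e mul0r addr0 -/(potential v) => le.
have {}le := le _.
have : - 2 * dot q v <= 2 * (1 + 2 * nu) * potential v.
  by apply: le => p; rewrite mul0r addr0 mulrC.
by move: (dot q v) (potential v) => x y; lra.
Qed.

(** Fubini turns the extended-real iterated integral into a finite plane integral. *)
Lemma energy0E phi psi a b : Xbd phi a -> Xbd psi b ->
  energy0 alpha w phi psi = (1 / 2 * dot psi psi + 1 / 2 * potential phi)%:E.
Proof.
move=> pa pb; have [iq _] := dot_bound pb pb.
have iW := kernel_integrable_Wprim pa.
rewrite /energy0 EFinD (EFinM (1 / 2)) (EFinM (1 / 2)); congr (_ * _ + _ * _)%E.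
  rewrite /dot /Rintegral fineK; last exact: integrable_fin_num iq.
  by apply: eq_integral => x _; rewrite expr2.
rewrite /potential /kernel_int /Rintegral fineK; last exact: integrable_fin_num iW.
by rewrite -(integral12_prod_meas1 iW).
Qed.

(** The case [e = 0] of the Lipschitz bound in [potential_taylor]. *)
Lemma potential_ae_eq v M v' : Xbd v M -> measurable_fun setT v' ->
  {ae mu, forall x, v' x = v x} -> potential v' = potential v.
Proof.
move=> vM mv' vv'; have mv := Xbd_measurable vM.
have [C C0 HC] := potential_taylor vM.
have z : {ae mu, forall x, `|v' x - v x| <= 0}.
  by apply: filterS vv' => x ->; rewrite subrr normr0.
have i0 : mu.-integrable setT (EFin \o (fun _ : R => 0 : R)) by exact: integrable0.
have id : mu.-integrable setT (EFin \o (fun x => v' x - v x)).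
  by apply: ae_le_integrable i0 z; exact: measurable_funB.
have [|] := HC v' 0 ler01.
  split => //; rewrite (ae_eq_Rintegral (g := fun _ => 0)).
  - by rewrite /Rintegral integral0.
  - by apply: measurableT_comp => //; exact: measurable_funB.
  - by [].
  - by apply: filterS z => x; rewrite normr_le0 => /eqP ->; rewrite normr0.
by rewrite mulr0 normr_le0 subr_eq0 => /eqP.
Qed.

End potential.

(** * Differential inequalities *)

Section calculus.
Context {R : realType}.

Lemma is_derive_eps (f : R -> R) (t l : R) :
  (forall e : R, 0 < e -> \forall s \near t, s != t ->
    `|(f s - f t) / (s - t) - l| <= e) -> is_derive t 1 f l.
Proof.
move=> H.
have fl : h^-1 *: ((f \o shift t) (h *: (1 : R)) - f t) @[h --> 0^'] --> l.
  apply/cvgrPdist_le => e e0; have /nbhs_ballP[d d0 hd] := H e e0.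
  exists d => // h /=; rewrite sub0r normrN => hd' h0.
  have /hd : ball t d (h + t) by rewrite /ball/= opprD addrCA subrr addr0 normrN.
  rewrite addrK -[_ == t]subr_eq0 addrK => /(_ h0).
  by rewrite distrC [X in h^-1 *: (f (X + t) - _)]mulr1 mulrC.
by split; [exact: cvgP fl|exact: cvg_lim fl].
Qed.

Lemma is_derive_within_continuous (f df : R -> R) (a b : R) :
  (forall t : R, a <= t -> is_derive t 1 f (df t)) ->
  {within `[a, b], continuous f}.
Proof.
move=> fd; apply: derivable_within_continuous => t /[!in_itv]/= /andP[/fd[]//].
Qed.

Lemma is_derive0_eq (f : R -> R) (a : R) :
  (forall t : R, a < t -> is_derive t 1 f 0) ->
  forall s t, a < s -> s <= t -> f t = f s.
Proof.
move=> fd s t as_ st.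
have fd' (x : R) : s <= x -> is_derive x 1 f 0.
  by move=> sx; apply: fd; exact: lt_le_trans sx.
have [x|c _ e] := @MVT_segment R f (cst 0) s t st _ (is_derive_within_continuous fd').
  by rewrite in_itv/= => /andP[/ltW/fd'].
by apply/eqP; rewrite -subr_eq0 e mul0r.
Qed.

(* A positive solution of [g' >= c g^2] explodes: [1 / g + c t] is nonincreasing. *)
Lemma riccati_blowup (g dg : R -> R) (a c : R) : 0 < c ->
  (forall t : R, a <= t -> is_derive t 1 g (dg t)) ->
  (forall t, a <= t -> c * g t ^+ 2 <= dg t) ->
  g a <= 0.
Proof.
move=> c0 gd gc; rewrite leNgt; apply/negP => ga.
have gpos t : a <= t -> 0 < g t.
  move=> at_; apply: (lt_le_trans ga); rewrite -subr_ge0.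
  have [x|s /[!in_itv]/= /andP[as_ _] ->] := @MVT_segment R g dg a t at_ _
    (is_derive_within_continuous gd).
    by rewrite in_itv/= => /andP[/ltW/gd].
  by rewrite mulr_ge0 ?subr_ge0// (le_trans _ (gc _ as_))// mulr_ge0 ?sqr_ge0// ltW.
have Vd (t : R) : a <= t -> is_derive t 1 (fun s => (g s)^-1) (- g t ^- 2 *: dg t).
  by move=> at_; have := gd t at_; apply: is_deriveV; rewrite gt_eqF ?gpos.
(* The time at which the upper bound [(g a)^-1 - c * (t - a)] for [(g t)^-1] reaches 0. *)
pose T := a + (c * g a)^-1.
have aT : a <= T by rewrite lerDl invr_ge0 ltW// mulr_gt0.
have [x|s /[!in_itv]/= /andP[as_ _] e] := @MVT_segment R (fun s => (g s)^-1)
    (fun t => - g t ^- 2 *: dg t) a T aT _ (is_derive_within_continuous Vd).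
  by rewrite in_itv/= => /andP[/ltW/Vd].
have gs := gpos _ as_; have gT := gpos _ aT.
have : - g s ^- 2 *: dg s <= - c.
  rewrite /GRing.scale/= mulNr lerN2 mulrC ler_pdivlMr ?exprn_gt0//.
  exact: gc.
have T0 : 0 <= T - a by rewrite subr_ge0.
move/(ler_wpM2r T0); rewrite -e.
have -> : - c * (T - a) = - (g a)^-1.
  by rewrite /T addrAC subrr add0r invfM mulrA mulNr divff ?gt_eqF// mulN1r.
by rewrite lerBlDr addNr leNgt invr_gt0 gT.
Qed.

End calculus.

(** * Differentiation in time *)

Section evolution.
Context {R : realType}.
Local Notation mu := (@lebesgue_measure R).

(** The constraint [0 <= s] makes this a right derivative at [t = 0]; for [t > 0] it is void near
    [t]. *)
Definition Xdiff (f : R -> R -> R) (f' : R -> R) (t : R) : Prop :=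
  [/\ exists a, Xbd (f t) a, exists a, Xbd f' a &
   forall e : R, 0 < e -> \forall s \near t, 0 <= s -> s != t ->
     Xbd (fun x => (f s x - f t x) / (s - t) - f' x) e].

Lemma near_scale_le (t a e : R) : 0 <= a -> 0 < e ->
  \forall s \near t, `|s - t| * a <= e.
Proof.
move=> a0 e0; have a1 : 0 < a + 1 by rewrite ltr_wpDl.
exists (e / (a + 1)); first exact: divr_gt0.
move=> s /=; rewrite distrC => /ltW st.
apply: (@le_trans _ _ (e / (a + 1) * (a + 1))); last by rewrite divfK ?gt_eqF.
by rewrite ler_pM// lerDl.
Qed.

Lemma Xdiff_lipschitz f f' t : Xdiff f f' t -> exists2 a : R, 0 <= a &
  \forall s \near t, 0 <= s -> s != t ->
    Xbd (fun x => f s x - f t x) (`|s - t| * a).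
Proof.
move=> [_ [a fa] H]; exists (1 + a); first by rewrite addr_ge0// (Xbd_ge0 fa).
apply: filterS (H 1 ltr01) => s H1 s0 st.
have := XbdZ (s - t) (XbdD (H1 s0 st) fa); congr Xbd.
by apply/funext => x; rewrite subrK mulrC divfK// subr_eq0.
Qed.

Lemma Xdiff_small f f' t (e : R) : Xdiff f f' t -> 0 < e ->
  \forall s \near t, 0 <= s -> s != t -> Xbd (fun x => f s x - f t x) e.
Proof.
move=> /Xdiff_lipschitz[a a0 H] e0.
apply: filterS2 H (near_scale_le t a0 e0) => s H le s0 st.
exact: Xbd_le le (H s0 st).
Qed.

Lemma dot_derive f f' g g' t : 0 < t -> Xdiff f f' t -> Xdiff g g' t ->
  is_derive t 1 (fun s => dot (f s) (g s)) (dot f' (g t) + dot (f t) g').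
Proof.
move=> t0 ff gg; apply: is_derive_eps => e e0.
have [[a fa] [a' fa'] Hf] := ff; have [[b gb] [b' gb'] Hg] := gg.
have [a0 a'0 b0] := And3 (Xbd_ge0 fa) (Xbd_ge0 fa') (Xbd_ge0 gb).
(* Sum of the coefficients of three errors: the quotient of [f] against [g s] ([b + 1]), [g s - g t]
   against [f'] ([a']), and the quotient of [g] against [f t] ([a]). *)
pose k := b + 1 + a' + a.
have k0 : 0 < k by rewrite /k -!addrA ltr_wpDl// ltr_pwDl// addr_ge0.
pose e1 := Num.min 1 (e / k).
have e10 : 0 < e1 by rewrite lt_min ltr01 divr_gt0.
have e11 : e1 <= 1 by rewrite ge_min lexx.
have e1k : e1 * k <= e by rewrite -ler_pdivlMr// ge_min lexx orbT.
have tpos : \forall s \near t, 0 <= s by apply: filterS (lt_nbhsr t0) => s /ltW.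
have Hs : \forall s \near t, 0 <= s -> s != t -> Xbd (fun x => g s x - g t x) e1.
  exact: Xdiff_small gg e10.
have Hfs : \forall s \near t, 0 <= s -> s != t -> Xbd (fun x => f s x - f t x) e1.
  exact: Xdiff_small ff e10.
near=> s => st.
have s0 : 0 <= s by near: s.
have gst : Xbd (fun x => g s x - g t x) e1 by move: s0 st; near: s.
have fst_ : Xbd (fun x => f s x - f t x) e1 by move: s0 st; near: s.
have rf : Xbd (fun x => (f s x - f t x) / (s - t) - f' x) e1.
  by move: s0 st; near: s; exact: Hf.
have rg : Xbd (fun x => (g s x - g t x) / (s - t) - g' x) e1.
  by move: s0 st; near: s; exact: Hg.
have {rf} : Xbd (fun x => (s - t)^-1 * (f s x - f t x) - f' x) e1.
  by move: rf; congr Xbd; apply/funext => x; rewrite mulrC.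
have {rg} : Xbd (fun x => (s - t)^-1 * (g s x - g t x) - g' x) e1.
  by move: rg; congr Xbd; apply/funext => x; rewrite mulrC.
move=> rg rf.
have gs : Xbd (g s) (b + 1).
  have : Xbd (fun x => g t x + (g s x - g t x)) (b + 1).
    by apply: Xbd_le (XbdD gb gst); rewrite lerD2l.
  by congr Xbd; apply/funext => x; ring.
have fs : Xbd (f s) (a + 1).
  have : Xbd (fun x => f t x + (f s x - f t x)) (a + 1).
    by apply: Xbd_le (XbdD fa fst_); rewrite lerD2l.
  by congr Xbd; apply/funext => x; ring.
have [_ d1] := dot_bound rf gs; have [_ d2] := dot_bound gst fa'.
have [_ d3] := dot_bound rg fa.
have E1 := dotBl (XbdZ (s - t)^-1 fst_) fa' gs.
rewrite (dotZl (s - t)^-1 fst_ gs) (dotBl fs fa gs) in E1.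
have E2 := dotBl gs gb fa'.
have E3 := dotBl (XbdZ (s - t)^-1 gst) gb' fa.
rewrite (dotZl (s - t)^-1 gst fa) (dotBl gs gb fa) in E3.
rewrite E1 in d1; rewrite E2 in d2; rewrite E3 in d3.
move: d1 d2 d3; rewrite (dotC (g s) f') (dotC (g t) f').
rewrite (dotC (g s) (f t)) (dotC (g t) (f t)) (dotC g' (f t)).
move: (dot (f s) (g s)) (dot (f t) (g s)) (dot f' (g s)).
move: (dot f' (g t)) (dot (f t) (g t)) (dot (f t) g').
move=> x4 x5 x6 x1 x2 x3 d1 d2 d3.
rewrite (_ : _ - _ = ((s - t)^-1 * (x1 - x2) - x3) + (x3 - x4) +
  ((s - t)^-1 * (x2 - x5) - x6)); last by ring.
apply: le_trans e1k; rewrite (le_trans (ler_normD _ _))//.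
rewrite (le_trans (lerD (le_trans (ler_normD _ _) (lerD d1 d2)) d3))//.
by rewrite -!mulrDr.
Unshelve. all: by end_near. Qed.

(** Together with [potential_lipschitz], this serves at [t = 0], where only one-sided information is
    available and [dot_derive] does not apply. *)
Lemma dot_lipschitz f f' t : Xdiff f f' t -> exists2 C : R, 0 <= C &
  \forall s \near t, 0 <= s -> s != t ->
    `|dot (f s) (f s) - dot (f t) (f t)| <= C * `|s - t|.
Proof.
move=> ff; have [[a fa] _ _] := ff; have a0 := Xbd_ge0 fa.
have [c c0 Hc] := Xdiff_lipschitz ff.
exists (c * (1 + 2 * a)); first by rewrite mulr_ge0// addr_ge0// mulr_ge0.
apply: filterS2 Hc (Xdiff_small ff ltr01) => s Hc H1 s0 st.
have {}Hc := Hc s0 st; have {}H1 := H1 s0 st.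
have fs : Xbd (f s) (a + 1).
  have := XbdD fa H1; congr Xbd; apply/funext => x; ring.
have [_ d1] := dot_bound Hc fs; have [_ d2] := dot_bound Hc fa.
rewrite (dotBl fs fa fs) in d1; rewrite (dotBl fs fa fa) (dotC (f s)) in d2.
rewrite (_ : _ - _ = (dot (f s) (f s) - dot (f t) (f s)) + (dot (f t) (f s) - dot (f t) (f t))).
  rewrite (le_trans (ler_normD _ _))// (le_trans (lerD d1 d2))//.
  by rewrite le_eqVlt; apply/orP; left; apply/eqP; ring.
by rewrite addrA subrK.
Qed.

Variables (alpha w : R -> R).
Hypothesis alpha_int : mu.-integrable setT (EFin \o alpha).
Hypothesis alpha_even : {ae mu, forall x, alpha (- x) = alpha x}.
Hypothesis alpha_ge0 : {ae mu, forall x, 0 <= alpha x}.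
Hypothesis w_der : forall x, derivable w x 1.
Hypothesis w_C1 : continuous (derive1 w).
Hypothesis w_odd : forall x, w (- x) = - w x.
Hypothesis w0 : w 0 = 0.

Lemma potential_lipschitz f f' t : Xdiff f f' t -> exists2 C : R, 0 <= C &
  \forall s \near t, 0 <= s -> s != t ->
    `|potential alpha w (f s) - potential alpha w (f t)| <= C * `|s - t|.
Proof.
move=> ff; have [[a fa] _ _] := ff.
have [c c0 Hc] := Xdiff_lipschitz ff.
have [C C0 HC] := potential_taylor alpha_int w_der w_C1 w0 fa.
exists (C * c); first exact: mulr_ge0.
apply: filterS2 Hc (near_scale_le t c0 ltr01) => s Hc H1 s0 st.
have [+ _] := HC _ _ H1 (Hc s0 st) => /le_trans; apply.
by rewrite -mulrA (mulrC c).
Qed.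

Lemma potential_derive f f' q a t : 0 < t -> Xdiff f f' t -> Xbd q a ->
  {ae mu, forall x, (q x)%:E = Lop alpha w (f t) x} ->
  is_derive t 1 (fun s => potential alpha w (f s)) (- 2 * dot q f').
Proof.
move=> t0 ff qa qL; apply: is_derive_eps => e e0.
have [[b fb] [b' fb'] Hf] := ff.
have [c c0 Hc] := Xdiff_lipschitz ff.
have [C C0 HC] := potential_taylor alpha_int w_der w_C1 w0 fb.
have a0 := Xbd_ge0 qa.
(* Half of [e] is for the Taylor remainder, half for twice the pairing of [q] with the error of the
   difference quotient; [a + 1] avoids dividing by 0. *)
pose e1 := e / (4 * (a + 1)).
have e10 : 0 < e1 by rewrite divr_gt0// mulr_gt0// ltr_wpDl.
have e1e : 2 * (a * e1) <= e / 2.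
  rewrite /e1 (_ : 2 * _ = e / 2 * (a / (a + 1))); last by field; rewrite gt_eqF// ltr_wpDl.
  by rewrite ler_piMr ?divr_ge0 ?ltW// ltr_pdivrMr ?mul1r ?ltrDl// ltr_wpDl.
have tpos : \forall s \near t, 0 <= s by apply: filterS (lt_nbhsr t0) => s /ltW.
have e20 : 0 < e / 2 by rewrite divr_gt0.
have Cc0 : 0 <= C * c ^+ 2 by rewrite mulr_ge0// sqr_ge0.
near=> s => st.
have s0 : 0 <= s by near: s.
have r : Xbd (fun x => (f s x - f t x) / (s - t) - f' x) e1.
  by move: s0 st; near: s; exact: Hf.
have {}r : Xbd (fun x => (s - t)^-1 * (f s x - f t x) - f' x) e1.
  by move: r; congr Xbd; apply/funext => x; rewrite mulrC.
have h : Xbd (fun x => f s x - f t x) (`|s - t| * c) by move: s0 st; near: s.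
have le1 : `|s - t| * c <= 1 by near: s; exact: near_scale_le.
have le2 : `|s - t| * (C * c ^+ 2) <= e / 2 by near: s; exact: near_scale_le.
have [_] := HC _ _ le1 h.
rewrite (Lop_weak alpha_int alpha_even w_der w_C1 w_odd w0 fb qa h qL).
have [_] := dot_bound r qa.
rewrite (dotBl (XbdZ (s - t)^-1 h) fb' qa) (dotZl (s - t)^-1 h qa).
rewrite (dotC _ q) (dotC f' q).
move: (potential alpha w (f s)) (potential alpha w (f t)) (dot q _) (dot q f').
move=> x1 x2 x3 x4 d1 d2.
have stn : s - t != 0 by rewrite subr_eq0.
rewrite (_ : _ - _ = (x1 - x2 - - 2 * x3) / (s - t) - 2 * ((s - t)^-1 * x3 - x4)); last by ring.
rewrite (le_trans (ler_normB _ _))//.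
have d2' : `|(x1 - x2 - - 2 * x3) / (s - t)| <= e / 2.
  apply: le_trans le2; rewrite normrM normfV ler_pdivrMr ?normr_gt0//.
  apply: (le_trans d2); rewrite le_eqVlt; apply/orP; left; apply/eqP; ring.
have d1' : `|2 * ((s - t)^-1 * x3 - x4)| <= e / 2.
  apply: le_trans e1e; rewrite normrM ger0_norm// ler_wpM2l//.
  by rewrite (mulrC a).
by rewrite [leRHS](splitr e) lerD.
Unshelve. all: by end_near. Qed.

End evolution.

(** * Blow-up *)

Lemma Xbd_inX {R : realType} (f : R -> R) e : Xbd f e -> inX f.
Proof.
move=> fe; split; first exact: Xbd_integrable fe.
by split; [exact: Xbd_measurable fe|exists e; case: fe].
Qed.

Lemma Xderiv_Xdiff {R : realType} (u v : R -> R -> R) :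
  (forall t, 0 <= t -> inX (u t) /\ inX (v t)) -> Xderiv u v ->
  forall t, 0 <= t -> Xdiff u (v t) t.
Proof.
move=> uvX duv t t0; have [/inX_Xbd[a ua] /inX_Xbd[b vb]] := uvX t t0.
split; [by exists a|by exists b|].
apply: Xlim_Xbd; last exact: duv.
move=> s s0 st; have [/inX_Xbd[c uc] _] := uvX s s0.
apply: (@Xbd_inX _ _ (`|(s - t)^-1| * (c + a) + b)).
have := XbdB (XbdZ (s - t)^-1 (XbdB uc ua)) vb; congr Xbd.
by apply/funext => x; rewrite mulrC.
Qed.

Section blowup.
Context {R : realType}.
Local Notation mu := (@lebesgue_measure R).
Variables (alpha w : R -> R).
Hypothesis alpha_int : mu.-integrable setT (EFin \o alpha).
Hypothesis alpha_even : {ae mu, forall x, alpha (- x) = alpha x}.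
Hypothesis alpha_ge0 : {ae mu, forall x, 0 <= alpha x}.
Hypothesis w_der : forall x, derivable w x 1.
Hypothesis w_C1 : continuous (derive1 w).
Hypothesis w_odd : forall x, w (- x) = - w x.
Hypothesis w0 : w 0 = 0.
Variables (u u1 u2 : R -> R -> R).
Hypothesis du : forall t, 0 <= t -> Xdiff u (u1 t) t.
Hypothesis du1 : forall t, 0 <= t -> Xdiff u1 (u2 t) t.
Hypothesis u_eq : forall t, 0 < t ->
  {ae mu, forall x, (u2 t x)%:E = Lop alpha w (u t) x}.

Definition energy (t : R) : R :=
  1 / 2 * dot (u1 t) (u1 t) + 1 / 2 * potential alpha w (u t).

(** The kinetic part contributes [dot (u2 t) (u1 t)] and the potential part its opposite. *)
Lemma energy_derive (t : R) : 0 < t -> is_derive t 1 energy 0.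
Proof.
move=> t0; have [_ [a ua] _] := du1 (ltW t0).
have d1 := dot_derive t0 (du1 (ltW t0)) (du1 (ltW t0)).
have d2 := potential_derive alpha_int alpha_even w_der w_C1 w_odd w0 t0
  (du (ltW t0)) ua (u_eq t0).
have D := is_deriveD (is_deriveZ (1 / 2) d1) (is_deriveZ (1 / 2) d2).
apply: (@is_derive_eq _ _ _ _ _ _ _ _ D).
rewrite (dotC (u1 t) (u2 t)) /GRing.scale/=.
by move: (dot _ _) => x; field.
Qed.

Lemma energy_conserved (t : R) : 0 < t -> energy t = energy 0.
Proof.
move=> t0.
have [C1 C10 H1] := dot_lipschitz (du1 (lexx 0)).
have [C2 C20 H2] := potential_lipschitz alpha_int w_der w_C1 w0 (du (lexx 0)).
apply/eqP; rewrite -subr_eq0 -normr_le0; apply/ler_addgt0Pr => e e0; rewrite add0r.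
have C120 : 0 <= C1 + C2 by rewrite addr_ge0.
(* Some [s] in []0, t]] has energy within [e] of the initial one; as the energy is constant at
   positive times, [t] inherits this bound. *)
have P : \forall s \near 0^'+, 0 < s /\ s <= t /\ `|energy s - energy 0| <= e.
  near=> s.
  have s0 : 0 < s by [].
  have le : `|s - 0| * (C1 + C2) <= e.
    by near: s; apply: cvg_within; exact: near_scale_le.
  split=> //; split; first by near: s; exact: nbhs_right_le.
  have l1 : `|dot (u1 s) (u1 s) - dot (u1 0) (u1 0)| <= C1 * `|s - 0|.
    have : 0 <= s -> s != 0 -> `|dot (u1 s) (u1 s) - dot (u1 0) (u1 0)| <= C1 * `|s - 0|.
      by near: s; apply: cvg_within; exact: H1.
    by apply; [exact: ltW|rewrite gt_eqF].
  have l2 : `|potential alpha w (u s) - potential alpha w (u 0)| <= C2 * `|s - 0|.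
    have : 0 <= s -> s != 0 ->
        `|potential alpha w (u s) - potential alpha w (u 0)| <= C2 * `|s - 0|.
      by near: s; apply: cvg_within; exact: H2.
    by apply; [exact: ltW|rewrite gt_eqF].
  apply: le_trans le; rewrite /energy.
  move: l1 l2; move: (dot (u1 s) _) (dot (u1 0) _) (potential _ _ (u s)) (potential _ _ (u 0)).
  move=> x1 x2 x3 x4 l1 l2.
  rewrite (_ : _ - _ = 1 / 2 * (x1 - x2) + 1 / 2 * (x3 - x4)); last by ring.
  rewrite (le_trans (ler_normD _ _))// !(normrM (1 / 2)) mulrDr (mulrC _ C1) (mulrC _ C2).
  have h : `|1 / 2 : R| <= 1 by rewrite ger0_norm//; lra.
  by apply: lerD; [apply: le_trans l1|apply: le_trans l2]; rewrite ler_piMl.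
have [s [s0 [st le]]] : exists s : R, 0 < s /\ s <= t /\ `|energy s - energy 0| <= e.
  by near (0 : R)^'+ => s; exists s; near: s.
by rewrite (is_derive0_eq energy_derive s0 st).
Unshelve. all: by end_near. Qed.

Lemma energy_ge0 (nu : R) : 0 < nu ->
  (forall eta, eta * w eta <= 2 * (1 + 2 * nu) * Wprim w eta) ->
  0 <= energy 0.
Proof.
move=> nu0 hc; rewrite leNgt; apply/negP => E0.
pose b := - 2 * energy 0.
have b0 : 0 < b by rewrite /b mulNr oppr_gt0 pmulr_rlt0.
(* Chosen so that [b * t0] absorbs a possibly negative [dot (u 1) (u1 1)], which leaves
   [B 1 >= b > 0]. *)
pose t0 := `|dot (u 1) (u1 1)| / b.
have t00 : 0 <= t0 by rewrite divr_ge0// ltW.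
pose F t := dot (u t) (u t) + b * (t + t0) ^+ 2.
pose B t := dot (u t) (u1 t) + b * (t + t0).
pose dB t := dot (u1 t) (u1 t) + dot (u t) (u2 t) + b.
have tpos (t : R) : 1 <= t -> 0 < t by exact: lt_le_trans.
have Fpos t : 1 <= t -> 0 < F t.
  move=> t1; rewrite ltr_wpDl ?dotff_ge0// mulr_gt0// exprn_gt0//.
  by rewrite ltr_pwDl// tpos.
have dsh (t : R) : is_derive t 1 (fun s : R => s + t0) 1.
  by apply: is_derive_eq; rewrite addr0.
have Fd (t : R) : 1 <= t -> is_derive t 1 F (2 * B t).
  move=> t1; have t0' := tpos _ t1.
  have d1 := dot_derive t0' (du (ltW t0')) (du (ltW t0')).
  have D := is_deriveD d1 (is_deriveZ b (is_deriveX 2 (dsh t))).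
  apply: (@is_derive_eq _ _ _ _ _ _ _ _ D).
  rewrite /B (dotC (u1 t)) /GRing.scale/= expr1 mulr1.
  by move: (dot _ _) => x; ring.
have Bd (t : R) : 1 <= t -> is_derive t 1 B (dB t).
  move=> t1; have t0' := tpos _ t1.
  have d1 := dot_derive t0' (du (ltW t0')) (du1 (ltW t0')).
  have D := is_deriveD d1 (is_deriveZ b (dsh t)).
  apply: (@is_derive_eq _ _ _ _ _ _ _ _ D).
  by rewrite /dB /GRing.scale/= mulr1.
(* As [B] is half of F', this is half of F'/F, and the Riccati constant becomes [2 * nu]. *)
pose g t := B t * (F t)^-1.
pose dg t := B t * (- F t ^- 2 * (2 * B t)) + (F t)^-1 * dB t.
have gd (t : R) : 1 <= t -> is_derive t 1 g (dg t).
  move=> t1; have Fn : F t != 0 by rewrite gt_eqF// Fpos.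
  have D := is_deriveM (Bd t t1) (is_deriveV Fn (Fd t t1)).
  by apply: (@is_derive_eq _ _ _ _ _ _ _ _ D).
(* Energy conservation reads: minus the potential equals [dot (u1 t) (u1 t) + b]. Inserting this in
   [dot_Lop_ge] gives the factor [1 + (1 + 2 * nu)]. *)
have dBge t : 1 <= t -> 2 * (1 + nu) * (dot (u1 t) (u1 t) + b) <= dB t.
  move=> t1; have t0' := tpos _ t1.
  have [[a ua] _ _] := du (ltW t0'); have [_ [c uc] _] := du1 (ltW t0').
  have := dot_Lop_ge alpha_int alpha_even alpha_ge0 w_der w_C1 w_odd w0 ua uc (u_eq t0') hc.
  have := energy_conserved t0'; rewrite /dB /b (dotC (u2 t)) /energy.
  move: (energy 0) (dot (u1 t) _) (dot (u t) _) (potential _ _ _) => e x y p.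
  by move=> <-; lra.
have gge t : 1 <= t -> 2 * nu * g t ^+ 2 <= dg t.
  move=> t1; have t0' := tpos _ t1; have Ft := Fpos t t1.
  have [[a ua] [c uc] _] := du (ltW t0').
  have CS := cauchy_schwarz_plus (t := t + t0) ua uc (ltW b0) Ft.
  rewrite -/(B t) -/(F t) in CS.
  have {}CS : 2 * (1 + nu) * B t ^+ 2 <= F t * dB t.
    apply: (@le_trans _ _ (2 * (1 + nu) * (F t * (dot (u1 t) (u1 t) + b)))).
      by rewrite ler_wpM2l// mulr_ge0// addr_ge0// ltW.
    by rewrite mulrCA ler_wpM2l ?dBge// ltW.
  (* The quotient rule gives [dg = (F * dB - 2 * B ^+ 2) / F ^+ 2]: it uses up 2 of the factor
     [2 * (1 + nu)] and leaves [2 * nu]. *)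
  rewrite -subr_ge0 (_ : _ - _ = (F t * dB t - 2 * (1 + nu) * B t ^+ 2) / F t ^+ 2).
    by rewrite divr_ge0 ?subr_ge0// sqr_ge0.
  by rewrite /dg /g; move: (F t) (B t) (dB t) Ft => x y z x0; field; rewrite gt_eqF.
have : g 1 <= 0 by apply: (riccati_blowup _ gd gge); rewrite mulr_gt0.
rewrite leNgt divr_gt0 ?Fpos//.
rewrite /B mulrDr mulr1 (_ : b * t0 = `|dot (u 1) (u1 1)|).
  by rewrite addrCA ltr_pwDl// -lerBlDr sub0r lerNl -normrN ler_norm.
by rewrite /t0 mulrCA divff ?gt_eqF// mulr1.
Qed.

End blowup.

Unset Implicit Arguments.

Theorem theorem4p4 (R : realType) (alpha w phi psi : R -> R) (nu : R)
  (halpha : inL1 alpha)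
  (halpha_even : {ae (@lebesgue_measure R), forall x, alpha (- x) = alpha x})
  (halpha_ge0 : {ae (@lebesgue_measure R), forall x, 0 <= alpha x})
  (hw_der : forall x, derivable w x 1)
  (hw_C1 : continuous (derive1 w))
  (hw_odd : forall x, w (- x) = - w x)
  (hw0 : w 0 = 0)
  (hphi : inX phi) (hpsi : inX psi)
  (hnu : 0 < nu)
  (hcond : forall eta, eta * w eta <= 2 * (1 + 2 * nu) * Wprim w eta)
  (hE : (energy0 alpha w phi psi < 0)%E) :
  ~ exists u : R -> R -> R, global_solution alpha w phi psi u.
Proof.
move=> [u [u1 [u2 [[uX [du [du1 _]]] [u_eq [u0 u10]]]]]].
have {}du : forall t, 0 <= t -> Xdiff u (u1 t) t.
  by apply: Xderiv_Xdiff du => t /uX[? []].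
have {}du1 : forall t, 0 <= t -> Xdiff u1 (u2 t) t.
  by apply: Xderiv_Xdiff du1 => t /uX[? []].
have := energy_ge0 halpha halpha_even halpha_ge0
  hw_der hw_C1 hw_odd hw0 du du1 u_eq hnu hcond.
apply/negP; rewrite -ltNge.
have [a pa] := inX_Xbd hphi; have [b pb] := inX_Xbd hpsi.
move: hE; rewrite (energy0E halpha hw_der hw_C1 hw0 pa pb) lte_fin.
have [[c uc] [d u1d] _] := du 0 (lexx 0).
(* The initial data are attained only a.e., so each half of the energy is transferred through an
   integral that ignores null sets. *)
rewrite /energy (potential_ae_eq halpha hw_der hw_C1 hw0 pa _ u0); last exact: Xbd_measurable uc.
have -> // : dot (u1 0) (u1 0) = dot psi psi.
have mu1 := Xbd_measurable u1d; have mp := Xbd_measurable pb.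
apply: ae_eq_Rintegral; [exact: measurable_funM|exact: measurable_funM|].
by apply: filterS u10 => x ->.
Qed.
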